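(* Let $G$ be a triangle-free graph with $\operatorname{diam}(G)=\operatorname{diam}(\overline{G})=3$ and $\kappa(G)\ge 3$, where $\overline{G}$ is the complement of $G$. Then $G$ is reconstructible; that is, every graph $H$ with $\mathcal{D}(H)=\mathcal{D}(G)$ is isomorphic to $G$.
   Context: All graphs are finite and simple. $\operatorname{diam}(G)=\max_{u,v\in V(G)} d_G(u,v)$, where $d_G(u,v)$ is the length of a shortest path from $u$ to $v$ in $G$ (so a graph of finite diameter is connected). For a connected graph $G$, a set $S\subseteq V(G)$ is a cut set if $G-S$ is disconnected; the connectivity $\kappa(G)$ is the size of a smallest cut set. A card of $G$ is a graph $G-v$ with $v\in V(G)$, and the deck of $G$ is the multiset $\mathcal{D}(G)=\{G-v: v\in V(G)\}$, with cards considered up to isomorphism. Thus $\mathcal{D}(H)=\mathcal{D}(G)$ means there is a bijection $\varphi:V(G)\to V(H)$ with $G-v\cong H-\varphi(v)$ for all $v\in V(G)$. *)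

(* Defs.v *)
From mathcomp Require Import all_boot.
Set Implicit Arguments.
Unset Strict Implicit.
Unset Printing Implicit Defensive.

Record sgraph := SGraph {
  vertex :> finType;
  adj : rel vertex;
  adj_sym : symmetric adj;
  adj_irr : irreflexive adj }.

Section Graph.
Variable G : sgraph.

Definition compl_adj : rel G := [rel x y | (x != y) && ~~ adj x y].

Fact compl_adj_sym : symmetric compl_adj.
Proof. by move=> x y; rewrite /compl_adj /= eq_sym adj_sym. Qed.

Fact compl_adj_irr : irreflexive compl_adj.
Proof. by move=> x; rewrite /compl_adj /= eqxx. Qed.

Definition complement : sgraph := SGraph compl_adj_sym compl_adj_irr.

Definition induced_adj (A : {set G}) : rel {x : G | x \in A} :=
  [rel x y | adj (val x) (val y)].

Fact induced_adj_sym (A : {set G}) : symmetric (@induced_adj A).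
Proof. by move=> x y; rewrite /induced_adj /= adj_sym. Qed.

Fact induced_adj_irr (A : {set G}) : irreflexive (@induced_adj A).
Proof. by move=> x; rewrite /induced_adj /= adj_irr. Qed.

Definition induced (A : {set G}) : sgraph :=
  SGraph (@induced_adj_sym A) (@induced_adj_irr A).

Definition delete_set (S : {set G}) : sgraph := induced (~: S).

Definition card_at (v : G) : sgraph := delete_set [set v].

Definition triangle_free : Prop :=
  forall x y z : G, ~ [/\ adj x y, adj y z & adj x z].

(* The simple path x :: p has size p edges. *)
Definition has_path_of_length (x y : G) (n : nat) : bool :=
  [exists p : n.-tuple G,
    [&& path (@adj G) x p, last x p == y & uniq (x :: p)]].

(* A simple path has fewer than #|G| edges, so the search is exhaustive;
   the value is the junk #|G| when no path joins x to y. *)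
Definition dist (x y : G) : nat :=
  find (has_path_of_length x y) (iota 0 #|G|).

Definition connected : bool := [forall x : G, forall y : G, connect (@adj G) x y].

(* None stands for an infinite diameter. *)
Definition diam : option nat :=
  if connected then Some (\max_(x : G) \max_(y : G) dist x y) else None.

End Graph.

Definition cut_set (G : sgraph) (S : {set G}) : bool :=
  ~~ connected (delete_set S).

(* A cut set has at most #|G| - 2 elements, so the default value #|G|.-1 is
   only attained by graphs without cut sets, i.e. complete graphs. *)
Definition connectivity (G : sgraph) : nat :=
  \big[minn/#|G|.-1]_(S : {set G} | cut_set S) #|S|.

Definition isomorphic (G H : sgraph) : Prop :=
  exists2 f : G -> H, bijective f & forall x y : G, adj (f x) (f y) = adj x y.

Definition same_deck (G H : sgraph) : Prop :=
  exists2 phi : G -> H, bijective phi &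
    forall v : G, isomorphic (card_at v) (card_at (phi v)).

Definition reconstructible (G : sgraph) : Prop :=
  forall H : sgraph, same_deck G H -> isomorphic H G.

(* Main.v *)
Require Import Defs.
From mathcomp Require Import all_boot.
From mathcomp Require Import zify.

Set Implicit Arguments.
Unset Strict Implicit.
Unset Printing Implicit Defensive.

(** Since the complement has diameter 3, some pair u, v is at distance 3 in it:
    u and v are adjacent in G and every vertex is adjacent to one of them.  As G
    has no triangle, no vertex is adjacent to both, so G is bipartite with sides
    N(u), which contains v, and N(v), which contains u.  By symmetry let
    #|N(v)| <= #|N(u)|.

    Let H have the same deck, and let w be the vertex of H whose card is
    isomorphic to G - u.  Kelly's counting argument ([same_deck_degree]) gives
    w the degree #|N(u)|, so H is obtained from G - u by adding a vertex with
    #|N(u)| neighbours.  If these neighbours met both sides of G - u, then a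
    neighbour x in N(u), a neighbour y in N(v) and a vertex b <> u adjacent to
    x would form a closed walk w, x, b, v, y of odd length.  It misses a vertex
    of H, because G has at least 6 vertices, so it would survive in a card;
    but all cards are bipartite ([same_deck_colouring]).  Hence N(w) lies within
    one side of G - u; the side N(v) :\ u is too small, so N(w) is
    exactly the side N(u), and H is isomorphic to G ([extend_isomorphism]).

    Connectivity at least 3 enters through the minimum degree only: it makes
    both sides have at least 3 vertices, and provides the vertex b. *)

(** * Counting edges in the deck *)

Definition neighbours (G : sgraph) (x : G) : {set G} := [set y | adj x y].

Definition degree (G : sgraph) (x : G) : nat := \sum_(y : G) adj x y.

Lemma card_neighbours (G : sgraph) (x : G) : #|neighbours x| = degree x.
Proof.
rewrite -sum1_card /degree big_mkcond /=; apply: eq_bigr => y _.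
by rewrite inE; case: adj.
Qed.

Definition degree_sum (G : sgraph) : nat := \sum_(x : G) degree x.

Lemma isomorphic_degree_sum (G H : sgraph) :
  isomorphic G H -> degree_sum G = degree_sum H.
Proof.
case=> f f_bij f_adj; rewrite /degree_sum [RHS](reindex f) /=; last exact: onW_bij.
apply: eq_bigr => x _; rewrite /degree [RHS](reindex f) /=; last exact: onW_bij.
by apply: eq_bigr => y _; rewrite f_adj.
Qed.

Lemma sum_card_at (G : sgraph) (v : G) (F : G -> nat) :
  (\sum_(x : card_at v) F (val x)) + F v = \sum_(x : G) F x.
Proof.
rewrite [RHS](bigD1 v) //= addnC; congr (_ + _).
rewrite -(big_sub (~: [set v])).
by apply: eq_bigl => x; rewrite !inE.
Qed.

Lemma card_at_degree (G : sgraph) (v : G) (x : card_at v) :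
  degree x + adj (val x) v = degree (val x).
Proof. exact: sum_card_at (fun y => adj (val x) y : nat). Qed.

Lemma card_at_degree_sum (G : sgraph) (v : G) :
  degree_sum (card_at v) + 2 * degree v = degree_sum G.
Proof.
rewrite /degree_sum -(sum_card_at v (@degree G)).
have -> : \sum_(x : card_at v) degree (val x) =
          \sum_(x : card_at v) degree x + \sum_(x : card_at v) adj (val x) v.
  by rewrite -big_split; apply: eq_bigr => x _; rewrite -card_at_degree.
have -> : degree v = \sum_(x : card_at v) adj (val x) v.
  rewrite /degree -(sum_card_at v) adj_irr addn0.
  by apply: eq_bigr => x _; rewrite adj_sym.
lia.
Qed.

(** Each edge is missing from exactly two cards, so the deck determines the
    number of edges, and then the degree of a vertex is the number of edges
    that its card lacks. *)
Lemma same_deck_degree (G H : sgraph) (phi : G -> H) :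
    bijective phi -> (forall v, isomorphic (card_at v) (card_at (phi v))) ->
    2 < #|G| -> forall v, degree (phi v) = degree v.
Proof.
move=> phi_bij phi_card G_gt2.
have cardHG : #|H| = #|G| by rewrite (bij_eq_card phi_bij).
have sum_cards (K : sgraph) :
    \sum_(v : K) degree_sum (card_at v) + 2 * degree_sum K = #|K| * degree_sum K.
  have -> : 2 * degree_sum K = \sum_(v : K) 2 * degree v by rewrite -big_distrr.
  rewrite -big_split /=.
  under eq_bigr => v _ do rewrite card_at_degree_sum.
  by rewrite sum_nat_const.
have eq_cards v := isomorphic_degree_sum (phi_card v).
have eq_sum : degree_sum G = degree_sum H.
  have := sum_cards H; rewrite (reindex phi) /=; last exact: onW_bij.
  under eq_bigr => v _ do rewrite -eq_cards.
  by have := sum_cards G; rewrite cardHG; nia.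
by move=> v; have := card_at_degree_sum v; have := card_at_degree_sum (phi v);
   rewrite -eq_cards eq_sum; lia.
Qed.

(** * Isomorphisms between cards *)

Lemma in_card_at (G : sgraph) (v x : G) : x != v -> x \in ~: [set v].
Proof. by rewrite !inE. Qed.

Lemma card_at_neq (G : sgraph) (v : G) (x : card_at v) : val x != v.
Proof. by have := valP x; rewrite !inE. Qed.

Lemma isomorphic_sym (G H : sgraph) : isomorphic G H -> isomorphic H G.
Proof.
case=> f [g fK gK] f_adj; exists g; first by exists f.
by move=> x y; rewrite -f_adj !gK.
Qed.

Lemma extend_isomorphism (G H : sgraph) (u : G) (w : H)
    (f : card_at u -> card_at w) :
    bijective f -> (forall x y, adj (f x) (f y) = adj x y) ->
    (forall x, adj w (val (f x)) = adj u (val x)) -> isomorphic G H.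
Proof.
move=> [g fK gK] f_adj f_new.
pose extend (K L : sgraph) (a : K) (b : L) (h : card_at a -> card_at b) x :=
  if insub x is Some y then val (h y) else b.
have extend_old K L a b h (x : card_at a) : @extend K L a b h (val x) = val (h x).
  by rewrite /extend valK.
have extend_new K L a b h : @extend K L a b h a = b.
  by rewrite /extend insubF // !inE eqxx.
have old_or_new (K : sgraph) (a x : K) : x = a \/ exists y : card_at a, x = val y.
  case: (eqVneq x a) => [|x_a]; [by left|right].
  by exists (Sub x (in_card_at x_a)).
exists (extend G H u w f).
  exists (extend H G w u g) => x.
    by case: (old_or_new G u x) => [->|[y ->]]; rewrite ?extend_new // !extend_old fK.
  by case: (old_or_new H w x) => [->|[y ->]]; rewrite ?extend_new // !extend_old gK.
move=> x y.
case: (old_or_new G u x) => [->|[x' ->]]; case: (old_or_new G u y) => [->|[y' ->]];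
  rewrite ?extend_new ?extend_old.
- by rewrite !adj_irr.
- exact: f_new.
- by rewrite adj_sym f_new adj_sym.
- exact: f_adj.
Qed.

(** A vertex missed by S can be deleted without touching S, and the resulting
    card is a card of G. *)
Lemma same_deck_colouring (G H : sgraph) (c : G -> bool) :
    (forall x y, adj x y -> c x != c y) -> same_deck G H ->
    forall S : {set H}, #|S| < #|H| ->
    exists d : H -> bool, {in S &, forall x y, adj x y -> d x != d y}.
Proof.
move=> c_proper [phi [psi phiK psiK] phi_card] S S_small.
have [w wS] : exists w, w \notin S.
  have: 0 < #|~: S| by rewrite cardsCs setCK subn_gt0.
  by case/card_gt0P => w; rewrite inE; exists w.
have [f [g fK gK] f_adj] := phi_card (psi w); rewrite psiK in f g fK gK f_adj.
exists (fun x => if insub x is Some y then c (val (g y)) else true).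
have old x : x \in S -> x \in ~: [set w].
  by move=> xS; apply: in_card_at; apply: contraNneq wS => <-.
move=> x y xS yS; rewrite !insubT ?old // => ? ? xy.
by apply: c_proper; rewrite -[adj _ _]f_adj !gK.
Qed.

(** * Minimum degree and connectivity *)

Lemma bigmin_leq (I : eqType) (r : seq I) (P : pred I) (F : I -> nat) (m : nat) i :
  i \in r -> P i -> \big[minn/m]_(j <- r | P j) F j <= F i.
Proof.
move=> + Pi; elim: r => //= j r IHr; rewrite big_cons in_cons => /orP[/eqP <-|/IHr].
  by rewrite Pi geq_minl.
by case: (P j) => // le; apply: leq_trans (geq_minr _ _) le.
Qed.

Lemma connectivity_le (G : sgraph) (S : {set G}) : cut_set S -> connectivity G <= #|S|.
Proof. by move=> S_cut; apply: bigmin_leq => //; rewrite mem_index_enum. Qed.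

(** Deleting the neighbours of x isolates x from a vertex that is not adjacent
    to it. *)
Lemma connectivity_le_degree (G : sgraph) (x y : G) :
  y != x -> ~~ adj x y -> connectivity G <= degree x.
Proof.
move=> yx xy; rewrite -card_neighbours; apply: connectivity_le.
have xS : x \in ~: neighbours x by rewrite !inE adj_irr.
have yS : y \in ~: neighbours x by rewrite !inE.
apply/negP => /forallP/(_ (Sub x xS))/forallP/(_ (Sub y yS))/connectP[[|z p] /=].
  by move=> _ /(congr1 val)/= e; rewrite e eqxx in yx.
case/andP => xz _ _; have := valP z; rewrite !inE.
by rewrite /induced_adj /= in xz; rewrite xz.
Qed.

Lemma connected_neighbour (G : sgraph) (x y : G) :
  connected G -> y != x -> exists z, adj x z.
Proof.
move=> /forallP/(_ x)/forallP/(_ y)/connectP[[|z p] /=].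
  by move=> _ ->; rewrite eqxx.
by case/andP => xz _ _ _; exists z.
Qed.

(** * Complements of diameter 3 *)

Lemma diam_attained (G : sgraph) (d : nat) :
  diam G = Some d.+1 -> exists x y : G, dist x y = d.+1.
Proof.
rewrite /diam; case: ifP => // _ [max_eq].
have G_gt0 : 0 < #|G|.
  by case: posnP => // G0; move: max_eq; rewrite big_pred0 // => x; have := fintype0 x.
have [x maxx] := eq_bigmax (fun x : G => \max_(y : G) dist x y) G_gt0.
have [y maxy] := eq_bigmax (fun y : G => dist x y) G_gt0.
by exists x, y; rewrite -maxy -maxx.
Qed.

Lemma dist_no_path (G : sgraph) (x y : G) (n : nat) :
  n < dist x y -> has_path_of_length x y n = false.
Proof.
move=> lt_n; have := before_find 0 lt_n; rewrite nth_iota //.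
by apply: leq_trans lt_n _; rewrite -[#|G|](size_iota 0); apply: find_size.
Qed.

Lemma complement_diam3 (G : sgraph) :
    diam (complement G) = Some 3 ->
  exists u v : G, adj u v /\ forall x, adj u x || adj v x.
Proof.
move=> diamC; have [u [v d_uv]] : exists u v : G, @dist (complement G) u v = 3.
  exact: diam_attained diamC.
exists u, v.
have no_path n : n < 3 -> @has_path_of_length (complement G) u v n = false.
  by move=> n_lt3; apply: dist_no_path; rewrite d_uv.
have u_neq_v : u != v.
  apply/eqP => e; have /negP[] := negbT (no_path 0 isT).
  by apply/existsP; exists [tuple]; rewrite /= e eqxx.
have uv : adj u v.
  apply: contraFT (no_path 1 isT) => nuv.
  by apply/existsP; exists [tuple v]; rewrite /= /compl_adj /= inE eqxx u_neq_v nuv.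
split=> // x; apply: contraFT (no_path 2 isT); rewrite negb_or => /andP[ux vx].
have xu : u != x by apply: contraNneq vx => <-; rewrite adj_sym.
have xv : x != v by apply: contraNneq ux => ->.
apply/existsP; exists [tuple x; v].
by rewrite /= /compl_adj /= !inE eqxx negb_or u_neq_v xu xv ux adj_sym vx.
Qed.

(** * Reconstruction *)

Section DominatingEdge.
Variables (G : sgraph) (u v : G).
Hypothesis G_free : triangle_free G.
Hypothesis uv : adj u v.
Hypothesis uv_dom : forall x, adj u x || adj v x.

Lemma adj_other_end x : adj v x = ~~ adj u x.
Proof.
have := uv_dom x; case ux: (adj u x); case vx: (adj v x) => // _.
by case: (@G_free u v x).
Qed.

Lemma dominating_edge_colouring x y : adj x y -> adj u x != adj u y.
Proof.
move=> xy; apply/negP => /eqP e; have [ux|ux] := boolP (adj u x).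
  by case: (@G_free u x y); split=> //; rewrite -e.
case: (@G_free v x y); split=> //; rewrite adj_other_end //.
by rewrite -e.
Qed.

Lemma degree_dominating_edge : degree u + degree v = #|G|.
Proof.
rewrite -!card_neighbours -(cardsC (neighbours u)); congr (_ + #|pred_of_set _|).
by apply/setP => x; rewrite !inE adj_other_end.
Qed.

Hypothesis min_degree : forall x : G, 2 < degree x.
Hypothesis degree_le : degree v <= degree u.

Lemma other_neighbour x : exists2 b, b != u & adj x b.
Proof.
have : 0 < #|neighbours x :\ u|.
  by have := cardsD1 u (neighbours x); rewrite card_neighbours;
     have := min_degree x; case: (u \in _); lia.
by case/card_gt0P => b; rewrite !inE => /andP[]; exists b.
Qed.

Lemma dominating_edge_reconstructible : reconstructible G.
Proof.
move=> H deckGH; apply: isomorphic_sym; have [phi phi_bij phi_card] := deckGH.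
have G_gt5 : 5 < #|G|.
  by rewrite -degree_dominating_edge; apply: leq_add (min_degree u) (min_degree v).
have cardHG : #|H| = #|G| by rewrite (bij_eq_card phi_bij).
have deg_w : degree (phi u) = degree u.
  by apply: same_deck_degree => //; apply: ltn_trans G_gt5.
have [f f_bij f_adj] := phi_card u; set w := phi u in f f_bij f_adj deg_w.
apply: (extend_isomorphism f_bij f_adj).
have vu : v != u by apply: contraTneq uv => ->; rewrite adj_irr.
(* The neighbours of w cannot meet both sides: otherwise a closed walk of
   length 5 through w would be properly 2-coloured. *)
have one_side (x y : card_at u) : adj w (val (f x)) -> adj w (val (f y)) ->
    adj u (val x) -> adj u (val y).
  move=> wx wy ux; apply: contraT => uy.
  have vy : adj v (val y) by rewrite adj_other_end.
  have [b bu xb] := other_neighbour (val x).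
  have vb : adj v b.
    by rewrite adj_other_end; have := dominating_edge_colouring xb; rewrite ux.
  pose b' : card_at u := Sub b (in_card_at bu).
  pose v' : card_at u := Sub v (in_card_at vu).
  pose S := [set w; val (f x); val (f b'); val (f v'); val (f y)].
  have S_small : #|S| < #|H|.
    rewrite cardHG; apply: leq_ltn_trans G_gt5.
    by rewrite /S !cardsU !cards1; lia.
  have [d d_proper] := same_deck_colouring dominating_edge_colouring deckGH S_small.
  have walk (p q : card_at u) : adj (val p) (val q) -> adj (val (f p)) (val (f q)).
    by have /= := f_adj p q; rewrite /induced_adj /= => ->.
  have : [/\ d w != d (val (f x)), d (val (f x)) != d (val (f b')),
             d (val (f v')) != d (val (f b')), d (val (f v')) != d (val (f y))
           & d w != d (val (f y))].
    by split; apply: d_proper; rewrite ?walk // !inE eqxx ?orbT.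
  by case; do 5 case: (d _).
pose N := [set val x | x : card_at u & adj w (val (f x))].
have cardN : #|N| = degree u.
  rewrite card_imset; last exact: val_inj.
  rewrite -deg_w /degree -(sum_card_at w) adj_irr addn0.
  rewrite [RHS](reindex f) /=; last exact: onW_bij.
  by rewrite -sum1_card big_mkcond /=; apply: eq_bigr => x _; rewrite inE; case: adj.
have uN : u \notin N.
  by apply/imsetP => -[x _ e]; have := card_at_neq x; rewrite -e eqxx.
have N_side : N \subset neighbours u.
  apply/subsetP => z /imsetP[x]; rewrite inE => wx ->; rewrite inE.
  apply: contraT => ux.
  (* Otherwise N lies in the other side, which also contains u and has at most
     #|N| elements. *)
  have N_v : u |: N \subset neighbours v.
    rewrite subUset sub1set inE adj_sym uv; apply/subsetP => z' /imsetP[y].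
    rewrite !inE => wy ->; rewrite adj_other_end.
    by apply: contra ux; apply: one_side.
  have := subset_leq_card N_v; rewrite cardsU1 uN cardN card_neighbours; lia.
have N_eq : N = neighbours u.
  by apply/eqP; rewrite eqEcard N_side card_neighbours cardN leqnn.
move=> x; have : (val x \in N) = adj u (val x) by rewrite N_eq inE.
by rewrite mem_imset ?inE //; apply: val_inj.
Qed.

End DominatingEdge.

Unset Implicit Arguments.

Theorem theorem1p5 (G : sgraph)
    (hfree : triangle_free G)
    (hdiam : diam G = Some 3)
    (hdiamC : diam (complement G) = Some 3)
    (hconn : 3 <= connectivity G) :
  reconstructible G.
Proof.
have [u [v [uv uv_dom]]] := complement_diam3 hdiamC.
have conC : connected (complement G).
  by move: hdiamC; rewrite /diam; case: connected.
have min_degree (x : G) : 2 < degree x.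
  apply: leq_trans hconn _.
  have [y yx] : exists y, y != x.
    have [->|] := eqVneq x u; last by exists u; rewrite eq_sym.
    by exists v; apply: contraTneq uv => ->; rewrite adj_irr.
  have [z] := connected_neighbour (G := complement G) conC yx.
  by rewrite /= => /andP[xz]; apply: connectivity_le_degree; rewrite eq_sym.
case/orP: (leq_total (degree v) (degree u)) => le.
  exact: (dominating_edge_reconstructible hfree uv uv_dom min_degree le).
apply: (dominating_edge_reconstructible hfree _ _ min_degree le).
  by rewrite adj_sym.
by move=> x; rewrite orbC.
Qed.
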